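(* Let $T$ be a finite string over the alphabet $\{S,O\}$ that contains SSS as a substring (of consecutive letters). Then for every $n\ge 1$ the game with target string $T$ on a $1\times n$ grid is a draw.
   Context: Game with target string $T$: on a $1\times n$ grid, initially empty, two players alternately write either an S or an O in an empty cell. The first player whose move produces consecutive cells which, read from left to right, spell $T$ wins (no matter who wrote the individual letters). If all cells are filled without producing $T$, the play ends in a draw. Both players are assumed to play optimally: ''the game is a draw'' means that each player has a strategy guaranteeing that they do not lose. *)

(* Defs.v *)
From HB Require Import structures.
From mathcomp Require Import all_boot.

Set Implicit Arguments.
Unset Strict Implicit.
Unset Printing Implicit Defensive.

Inductive letter : Type := letS | letO.

Definition bool_of_letter (l : letter) : bool := if l is letS then true else false.
Definition letter_of_bool (b : bool) : letter := if b then letS else letO.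
Lemma bool_of_letterK : cancel bool_of_letter letter_of_bool.
Proof. by case. Qed.
HB.instance Definition _ := Finite.copy letter (can_type bool_of_letterK).

Inductive player : Type := First | Second.

Definition opponent (p : player) : player :=
  if p is First then Second else First.

(* [None] is an empty cell. *)
Definition board (n : nat) := n.-tuple (option letter).
Definition move (n : nat) := ('I_n * letter)%type.

Definition empty_board (n : nat) : board n := [tuple None | _ < n].

Definition legal n (b : board n) (m : move n) : bool := tnth b m.1 == None.

Definition write n (m : move n) (b : board n) : board n :=
  [tuple if i == m.1 then Some m.2 else tnth b i | i < n].

Definition spells (T : seq letter) n (b : board n) : bool :=
  infix [seq Some l | l <- T] b.

Definition full n (b : board n) : bool := None \notin b.

(* Histories list the moves played so far, the most recent one first. *)
Definition history (n : nat) := seq (move n).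

Definition board_after n (h : history n) : board n :=
  foldr (@write n) (empty_board n) h.

Definition to_move n (h : history n) : player :=
  if odd (size h) then Second else First.

Definition game_over (T : seq letter) n (h : history n) : bool :=
  spells T (board_after h) || full (board_after h).

Fixpoint is_play (T : seq letter) n (h : history n) : bool :=
  if h is m :: h' then
    [&& is_play T h', ~~ game_over T h' & legal (board_after h') m]
  else true.

(* On an actual play [h = m :: h'] the target is not yet spelled after [h'],
   so it is the move [m] that produces it. *)
Definition wins (T : seq letter) n (p : player) (h : history n) : Prop :=
  if h is _ :: h' then to_move h' = p /\ spells T (board_after h) else False.

Definition strategy (n : nat) := history n -> move n.

Fixpoint follows n (p : player) (s : strategy n) (h : history n) : Prop :=
  if h is m :: h' then follows p s h' /\ (to_move h' = p -> m = s h')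
  else True.

(* The first clause rules out avoiding defeat by proposing a move that cannot
   be made: such a "strategy" would admit no continuation at all. *)
Definition non_losing (T : seq letter) n (p : player) (s : strategy n) : Prop :=
  forall h : history n, is_play T h -> follows p s h ->
    (to_move h = p -> ~~ game_over T h -> legal (board_after h) (s h)) /\
    ~ wins T (opponent p) h.

Definition is_draw (T : seq letter) (n : nat) : Prop :=
  forall p : player, exists s : strategy n, non_losing T p s.

(* Main.v *)
Require Import Defs.
From mathcomp Require Import all_boot.

(** Whoever wants to avoid losing can prevent SSS, hence T, from ever being
    spelled, by anyone. The cells are grouped into the pairs [{2k, 2k+1}]; any
    three consecutive cells contain one of these pairs, so it is enough that no
    pair is ever filled with two S's ([not_spells]). The protecting player
    writes only O's, and answers an S that leaves the other cell of its pair
    empty by an O in that cell; when there is nothing to answer, an O in any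
    empty cell does no harm. After each move of that player no empty cell has
    an S as its partner ([guard_after_O]); one move of the opponent then cannot
    complete a pair of S's, and leaves at most one cell to be answered
    ([one_threat_after_move]). This works for either player because the empty
    board is itself guarded. *)

Set Implicit Arguments.
Unset Strict Implicit.
Unset Printing Implicit Defensive.

(** Boards are read as if padded with O's on the right. The last cell of a
    board of odd length then has a partner like any other, and empty cells
    always lie on the board. *)
Definition cell n (b : board n) (i : nat) : option letter :=
  nth (Some letO) b i.

Definition partner (i : nat) : nat := if odd i then i.-1 else i.+1.

Lemma partnerK : involutive partner.
Proof.
case=> [|i] //; rewrite /partner /=.
by case: (boolP (odd i)) => /= oi; rewrite ?oi // (negbTE oi).
Qed.

Lemma partner_neq i : (partner i == i) = false.
Proof.
case: i => [|i] //; rewrite /partner /=.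
by case: (odd i) => /=; [rewrite gtn_eqF | rewrite ltn_eqF].
Qed.

Lemma cell_write n (m : move n) (b : board n) j :
  cell (write m b) j = if j == m.1 then Some m.2 else cell b j.
Proof.
rewrite /cell; case: (ltnP j n) => [lt_jn | le_nj].
  by rewrite -!(tnth_nth _ _ (Ordinal lt_jn)) tnth_mktuple.
by rewrite !nth_default ?size_tuple // gtn_eqF // (leq_trans (ltn_ord m.1)).
Qed.

Lemma cell_ord n (b : board n) (i : 'I_n) : cell b i = tnth b i.
Proof. by rewrite (tnth_nth (Some letO)). Qed.

Lemma cell_empty_board n i : cell (empty_board n) i != Some letS.
Proof.
rewrite /cell; case: (ltnP i n) => [lt_in | le_ni].
  by rewrite -(tnth_nth _ _ (Ordinal lt_in)) tnth_mktuple.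
by rewrite nth_default ?size_tuple.
Qed.

Definition SS_pair n (b : board n) (i : nat) : bool :=
  (cell b i == Some letS) && (cell b (partner i) == Some letS).

Definition threat n (b : board n) (i : nat) : bool :=
  (cell b i == None) && (cell b (partner i) == Some letS).

Definition guarded n (b : board n) : Prop :=
  (forall i, ~~ SS_pair b i) /\ (forall i, ~~ threat b i).

Definition one_threat n (b : board n) : Prop :=
  (forall i, ~~ SS_pair b i) /\ (forall i j, threat b i -> threat b j -> i = j).

Lemma guarded_one_threat n (b : board n) : guarded b -> one_threat b.
Proof. by case=> nSS nth_; split=> // i j ti; case/negP: (nth_ i). Qed.

Lemma guarded_empty_board n : guarded (empty_board n).
Proof.
by split=> i; rewrite negb_and cell_empty_board ?orbT.
Qed.

(** Among three consecutive cells, the first two or the last two are a pair,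
    according to the parity of the first position. *)
Lemma not_spells (T : seq letter) n (b : board n) :
  infix [:: letS; letS; letS] T -> (forall i, ~~ SS_pair b i) -> ~~ spells T b.
Proof.
move=> SSS_T nSS; apply/negP => /(infix_trans _) sub_b.
have /infixP[s1 [s2 def_b]] : infix (nseq 3 (Some letS)) b.
  apply: sub_b; case/infixP: SSS_T => [t1 [t2 ->]].
  by rewrite !map_cat /=; apply/infixP; do 2 eexists.
have cellS k : k < 3 -> cell b (size s1 + k) = Some letS.
  move=> lt_k3; rewrite /cell def_b nth_cat ltnNge leq_addr /= addKn.
  by case: k lt_k3 => [|[|[|k]]].
have [odd_s1 | even_s1] := boolP (odd (size s1)).
  case/negP: (nSS (size s1 + 1)).
  by rewrite /SS_pair /partner addn1 /= odd_s1 -addn2 -addn1 !cellS.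
case/negP: (nSS (size s1 + 0)).
rewrite /SS_pair /partner addn0 (negbTE even_s1) -addn1.
by rewrite -{1}[size s1]addn0 !cellS.
Qed.

(** An O creates neither an S nor an empty cell, so it can only remove threats;
    if it answers the single one, none is left. *)
Lemma guard_after_O n (b : board n) (i : 'I_n) :
  one_threat b -> (forall j, threat b j -> threat b i) ->
  guarded (write (i, letO) b).
Proof.
move=> [nSS uniq_t] answer; split=> j; apply/negP; rewrite /SS_pair /threat.
  rewrite !cell_write /=; case: (j =P i) => // _; case: (partner j =P i) => [_|_].
    by rewrite andbF.
  exact/negP/(nSS j).
rewrite !cell_write /=; case: (j =P i) => // ne_ji.
case: (partner j =P i) => [_|_ tj]; first by rewrite andbF.
exact/ne_ji/(uniq_t _ _ tj)/(answer j).
Qed.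

(** A move at [i] disturbs no pair but that of [i]: the S's of a new pair
    would make [i] a threat beforehand, and a new threat must be the partner
    of [i]. *)
Lemma one_threat_after_move n (b : board n) (m : move n) :
  guarded b -> cell b m.1 = None -> one_threat (write m b).
Proof.
case: m => i l [nSS nthreat] /= bi.
have partner_i : cell b (partner i) != Some letS.
  by have := nthreat i; rewrite /threat bi eqxx.
have threatE j : threat (write (i, l) b) j -> j = partner i.
  rewrite /threat !cell_write /=; case: (j =P i) => // _.
  case: (partner j =P i) => [<- | _ tj]; first by rewrite partnerK.
  by case/negP: (nthreat j).
split=> [j | j k /threatE-> /threatE-> //].
rewrite /SS_pair !cell_write /=; case: (j =P i) => [-> | ne_ji].
  by rewrite partner_neq negb_and partner_i orbT.
case: (partner j =P i) => [def_i | _]; last exact: nSS.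
by rewrite -[j]partnerK def_i negb_and partner_i.
Qed.

Definition pairing_cell n (i0 : 'I_n) (b : board n) : 'I_n :=
  if [pick i : 'I_n | threat b i] is Some i then i
  else odflt i0 [pick i : 'I_n | tnth b i == None].

Definition pairing_strategy n (i0 : 'I_n) : strategy n :=
  fun h => (pairing_cell i0 (board_after h), letO).

Lemma pairing_cell_answers n (i0 : 'I_n) (b : board n) j :
  threat b j -> threat b (pairing_cell i0 b).
Proof.
move=> tj; have lt_jn : j < n.
  rewrite ltnNge; apply/negP => le_nj.
  by move: tj; rewrite /threat {1}/cell nth_default ?size_tuple.
rewrite /pairing_cell; case: pickP => // /(_ (Ordinal lt_jn)) /=.
by rewrite tj.
Qed.

Lemma pairing_cell_empty n (i0 : 'I_n) (b : board n) :
  ~~ full b -> tnth b (pairing_cell i0 b) == None.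
Proof.
rewrite negbK => /tnthP[k bk]; rewrite /pairing_cell.
case: pickP => [i /andP[] | _]; first by rewrite cell_ord.
by case: pickP => [i | /(_ k)] //=; rewrite -bk eqxx.
Qed.

Lemma to_move_cons n (m : move n) h : to_move (m :: h) = opponent (to_move h).
Proof. by rewrite /to_move /=; case: (odd _). Qed.

(** When it is not [p]'s turn, either [p] has just moved or the board is still
    empty, which is why guardedness can be claimed there and only there. *)
Lemma pairing_invariant T n (i0 : 'I_n) p (h : history n) :
  is_play T h -> follows p (pairing_strategy i0) h ->
  one_threat (board_after h) /\ (to_move h <> p -> guarded (board_after h)).
Proof.
elim: h => [_ _ | m h IHh].
  by split=> [|_]; first apply: guarded_one_threat; apply: guarded_empty_board.
case/and3P=> play_h _ legal_m [follows_h own_m].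
have [one_h guarded_h] := IHh play_h follows_h.
rewrite to_move_cons.
have [mine | theirs] : to_move h = p \/ to_move h <> p.
- by case: (to_move h) (p) => [] []; [left | right | right | left].
- have guarded_mh : guarded (board_after (m :: h)).
    rewrite (own_m mine) /=; apply: guard_after_O => // j.
    exact: pairing_cell_answers.
  by split=> //; apply: guarded_one_threat.
split; last by case: (to_move h) (p) theirs => [] [].
apply: one_threat_after_move; first exact: guarded_h.
by rewrite cell_ord; apply/eqP.
Qed.

Theorem theorem5 (T : seq letter) (hT : infix [:: letS; letS; letS] T)
  (n : nat) (hn : 0 < n) : is_draw T n.
Proof.
move=> p; exists (pairing_strategy (Ordinal hn)) => h play_h follows_h.
have [[nSS _] _] := pairing_invariant play_h follows_h.
split=> [_ |].
  by rewrite negb_or => /andP[_ nfull]; apply: pairing_cell_empty.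
case: h nSS {play_h follows_h} => [|m h] nSS; first by case.
by case=> _; apply/negP/not_spells.
Qed.
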